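(* Consider the consistent-read asynchronous iteration defined in the context with step size $0<\beta\le1$, an arbitrary deterministic starting vector $x_0$, a nonnegative integer $\tau$, and deterministic delay indices $k(j)$ satisfying $j-\tau\le k(j)\le j$. Let $\rho=\max_{l}\frac1n\sum_{r=1}^n|A_{lr}|$ and $\nu_\tau(\beta)=2\beta-\beta^2-2\rho\tau\beta^2$, and suppose $\nu_\tau(\beta)>0$. Then: (a) For every integer $m\ge \frac{\log(1/2)}{\log(1-\lambda_{\max}/n)}$, \[E_m\le\Big(1-\frac{\nu_\tau(\beta)}{2\kappa}\Big)E_0.\] (b) Let $T_0=\big\lceil \frac{\log(1/2)}{\log(1-\lambda_{\max}/n)}\big\rceil$, $T=T_0+\tau$, and \[\chi(\beta)=\frac{\rho\tau^2\beta^2\lambda_{\max}(1-\lambda_{\max}/n)^{-2\tau}}{n}.\] Then for every integer $r\ge1$ and every $m\ge rT$, \[E_m\le\Big(1-\frac{\nu_\tau(\beta)}{2\kappa}\Big)\Big(1-\frac{\nu_\tau(\beta)(1-\lambda_{\max}/n)^{\tau}}{2\kappa}+\chi(\beta)\Big)^{r-1}E_0.\]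
   Context: Let $n\ge2$ and let $A\in\mathbb{R}^{n\times n}$ be symmetric positive definite with all diagonal entries equal to $1$; let $b\in\mathbb{R}^n$ and $x^\star=A^{-1}b$. Let $\lambda_{\min},\lambda_{\max}$ be the smallest and largest eigenvalues of $A$ and $\kappa=\lambda_{\max}/\lambda_{\min}$. Write $(x,y)_A=y^TAx$ and $\|x\|_A=\sqrt{(x,x)_A}$; $e^{(1)},\dots,e^{(n)}$ are the standard basis vectors. Consistent-read iteration: let $d_0,d_1,\dots$ be i.i.d. random vectors, each uniformly distributed on $\{e^{(1)},\dots,e^{(n)}\}$; let $\tau\ge0$ be an integer and $k(0),k(1),\dots$ deterministic integers (not depending on the $d_j$) with $j-\tau\le k(j)\le j$; given $x_0\in\mathbb{R}^n$ and a step size $\beta$, define for $j\ge0$ \[\gamma_j=(x^\star-x_{k(j)},d_j)_A,\qquad x_{j+1}=x_j+\beta\gamma_jd_j.\] Define $E_m=\mathbb{E}[\|x_m-x^\star\|_A^2]$. *)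

(* Defs.v *)
From Stdlib Require Import Reals Lra Lia List ZArith.
Import ListNotations.
Open Scope R_scope.

(* Vectors in R^n: functions nat -> R (only indices 0..n-1 matter).
   Matrices: nat -> nat -> R. *)
Definition vec := nat -> R.
Definition mat := nat -> nat -> R.

Definition rsum (n : nat) (f : nat -> R) : R :=
  fold_right Rplus 0 (map f (seq 0 n)).

Definition matvec (n : nat) (A : mat) (x : vec) : vec :=
  fun i => rsum n (fun r => A i r * x r).

Definition Ainner (n : nat) (A : mat) (x y : vec) : R :=
  rsum n (fun i => y i * matvec n A x i).

Definition Anorm2 (n : nat) (A : mat) (x : vec) : R := Ainner n A x x.

Definition vsub (x y : vec) : vec := fun i => x i - y i.

Definition ebasis (i : nat) : vec := fun r => if Nat.eqb r i then 1 else 0.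

Definition nonzero_vec (n : nat) (v : vec) : Prop := exists i, (i < n)%nat /\ v i <> 0.

Definition symmetric (n : nat) (A : mat) : Prop :=
  forall i j, (i < n)%nat -> (j < n)%nat -> A i j = A j i.

Definition pos_def (n : nat) (A : mat) : Prop :=
  forall x, nonzero_vec n x -> Anorm2 n A x > 0.

Definition unit_diag (n : nat) (A : mat) : Prop :=
  forall i, (i < n)%nat -> A i i = 1.

Definition is_eigenvalue (n : nat) (A : mat) (lam : R) : Prop :=
  exists v, nonzero_vec n v /\ forall i, (i < n)%nat -> matvec n A v i = lam * v i.

Definition is_max_eigenvalue (n : nat) (A : mat) (lam : R) : Prop :=
  is_eigenvalue n A lam /\ forall mu, is_eigenvalue n A mu -> mu <= lam.
Definition is_min_eigenvalue (n : nat) (A : mat) (lam : R) : Prop :=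
  is_eigenvalue n A lam /\ forall mu, is_eigenvalue n A mu -> lam <= mu.

(* History x_0, ..., x_m of the consistent-read iteration, for a given
   realization d : nat -> nat of the direction indices (d j = i means
   d_j = e^{(i)}), delays k, step beta. *)
Fixpoint hist (n : nat) (A : mat) (xstar x0 : vec) (beta : R)
  (k : nat -> nat) (d : nat -> nat) (m : nat) : list vec :=
  match m with
  | O => [x0]
  | S j =>
      let h := hist n A xstar x0 beta k d j in
      let xj := nth j h x0 in
      let xk := nth (k j) h x0 in
      let gamma := Ainner n A (vsub xstar xk) (ebasis (d j)) in
      h ++ [fun r => xj r + beta * gamma * ebasis (d j) r]
  end.

Definition iterate n A xstar x0 beta k d m : vec :=
  nth m (hist n A xstar x0 beta k d m) x0.

Fixpoint all_seqs (n m : nat) : list (list nat) :=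
  match m with
  | O => [[]]
  | S m' => flat_map (fun i => map (fun l => i :: l) (all_seqs n m')) (seq 0 n)
  end.

(* E_m = E[ ||x_m - x*||_A^2 ], d_0..d_{m-1} i.i.d. uniform on the basis:
   exact finite expectation = average over all n^m equally likely outcomes. *)
Definition Err (n : nat) (A : mat) (xstar x0 : vec) (beta : R)
  (k : nat -> nat) (m : nat) : R :=
  fold_right Rplus 0
    (map (fun l => Anorm2 n A
            (vsub (iterate n A xstar x0 beta k (fun j => nth j l O) m) xstar))
         (all_seqs n m)) / (INR n ^ m).

Definition rho (n : nat) (A : mat) : R :=
  fold_right Rmax 0 (map (fun l => / INR n * rsum n (fun r => Rabs (A l r))) (seq 0 n)).

Definition nu (rh : R) (tau : nat) (beta : R) : R :=
  2 * beta - beta ^ 2 - 2 * rh * INR tau * beta ^ 2.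

Definition ceilZ (x : R) : Z := (- Int_part (- x))%Z.

(* Main.v *)
(* Let g_j be the mean of gamma_j^2. Expanding the A-norm of the error along d_j, and writing x_j as
   x_k(j) plus the updates in between, gives
     E_{j+1} <= E_j - beta (2 - beta) g_j + beta^2 rho sum_{k(j) <= t < j} (g_j + g_t),
   where each cross term gamma_j gamma_t A_{d_j d_t} is split by AM-GM and averaged over the index on
   which the remaining square does not depend. Adding beta^2 rho sum_{u=1}^{tau} (tau - u + 1) g_{j-u}
   to E_j yields a Lyapunov function that drops by at least nu g_j in each step and exceeds E_j by at
   most chi E_j. Moreover g_j >= (lmin / n) E_k(j), and no step along d_j beats the exact line search,
   so E_{j+1} >= (1 - lmax / n) E_j; summing the resulting geometric series bounds the total drop from
   below. *)

Require Import Defs.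
From Stdlib Require Import Reals Lra Lia List ZArith FunctionalExtensionality Classical.
Open Scope R_scope.

(** * Finite sums *)

Lemma rsum_S (n : nat) (f : nat -> R) : rsum (S n) f = rsum n f + f n.
Proof.
  unfold rsum. rewrite seq_S, map_app, fold_right_app. simpl.
  generalize (map f (seq 0 n)) as l. induction l as [|x l IH]; simpl; [|rewrite IH]; ring.
Qed.

Lemma rsum_ext (n : nat) (f g : nat -> R) :
  (forall i, (i < n)%nat -> f i = g i) -> rsum n f = rsum n g.
Proof.
  induction n as [|n IH]; intros H; [reflexivity|].
  rewrite !rsum_S, IH, (H n) by auto with arith. reflexivity.
Qed.

Lemma rsum_le (n : nat) (f g : nat -> R) :
  (forall i, (i < n)%nat -> f i <= g i) -> rsum n f <= rsum n g.
Proof.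
  induction n as [|n IH]; intros H; [apply Rle_refl|].
  rewrite !rsum_S. apply Rplus_le_compat; auto with arith.
Qed.

Lemma rsum_plus (n : nat) (f g : nat -> R) :
  rsum n (fun i => f i + g i) = rsum n f + rsum n g.
Proof.
  induction n as [|n IH]; [unfold rsum; simpl; ring|]. rewrite !rsum_S, IH. ring.
Qed.

Lemma rsum_scal (n : nat) (c : R) (f : nat -> R) :
  rsum n (fun i => c * f i) = c * rsum n f.
Proof.
  induction n as [|n IH]; [unfold rsum; simpl; ring|]. rewrite !rsum_S, IH. ring.
Qed.

Lemma rsum_const (n : nat) (c : R) : rsum n (fun _ => c) = INR n * c.
Proof.
  induction n as [|n IH]; [unfold rsum; simpl; ring|]. rewrite rsum_S, IH, S_INR. ring.
Qed.

Lemma rsum_swap (n m : nat) (f : nat -> nat -> R) :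
  rsum n (fun i => rsum m (fun j => f i j)) = rsum m (fun j => rsum n (fun i => f i j)).
Proof.
  induction n as [|n IH].
  - change (0 = rsum m (fun _ => 0)). rewrite rsum_const. ring.
  - rewrite rsum_S, IH, <- rsum_plus. apply rsum_ext. intros; rewrite rsum_S; ring.
Qed.

Lemma rsum_nonneg (n : nat) (f : nat -> R) :
  (forall i, (i < n)%nat -> 0 <= f i) -> 0 <= rsum n f.
Proof.
  intros H. replace 0 with (rsum n (fun _ => 0)) by (rewrite rsum_const; ring).
  now apply rsum_le.
Qed.

Lemma rsum_split (p n : nat) (f : nat -> R) :
  rsum (p + n) f = rsum p f + rsum n (fun i => f (p + i)%nat).
Proof.
  induction n as [|n IH].
  - rewrite Nat.add_0_r. unfold rsum at 3; simpl. ring.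
  - rewrite Nat.add_succ_r, !rsum_S, IH. ring.
Qed.

Lemma rsum_ebasis (n i : nat) (f : nat -> R) :
  (i < n)%nat -> rsum n (fun r => ebasis i r * f r) = f i.
Proof.
  revert i; induction n as [|n IH]; intros i Hi; [lia|].
  rewrite rsum_S. unfold ebasis at 2. destruct (Nat.eqb_spec n i) as [->|Hne].
  - rewrite (rsum_ext _ _ (fun _ => 0)); [rewrite rsum_const; ring|].
    intros j Hj. unfold ebasis. destruct (Nat.eqb_spec j i); [lia|ring].
  - rewrite IH by lia. ring.
Qed.

Lemma rsum_term_le (n i : nat) (f : nat -> R) :
  (forall j, (j < n)%nat -> 0 <= f j) -> (i < n)%nat -> f i <= rsum n f.
Proof.
  intros Hf Hi. rewrite <- (rsum_ebasis n i f Hi). apply rsum_le. intros j Hj.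
  unfold ebasis. specialize (Hf j Hj). destruct (Nat.eqb j i); lra.
Qed.

Lemma rsum_geom (q : R) (n : nat) : rsum n (fun i => q ^ i) * (1 - q) = 1 - q ^ n.
Proof.
  induction n as [|n IH]; [unfold rsum; simpl; ring|].
  rewrite rsum_S, Rmult_plus_distr_r, IH. simpl; ring.
Qed.

(** * Symmetric matrices *)

Definition dot (n : nat) (x y : vec) : R := rsum n (fun i => x i * y i).

Lemma dot_nonneg (n : nat) (x : vec) : 0 <= dot n x x.
Proof. apply rsum_nonneg. intros. nra. Qed.

Lemma dot_pos (n : nat) (x : vec) : nonzero_vec n x -> 0 < dot n x x.
Proof.
  intros [i [Hi Hx]].
  apply Rlt_le_trans with (x i * x i); [nra|].
  apply (rsum_term_le n i (fun i => x i * x i)); [intros; nra|assumption].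
Qed.

Lemma matvec_add (n : nat) (A : mat) (x y : vec) (c : R) (i : nat) :
  matvec n A (fun r => x r + c * y r) i = matvec n A x i + c * matvec n A y i.
Proof.
  unfold matvec. rewrite <- rsum_scal, <- rsum_plus. apply rsum_ext. intros; ring.
Qed.

Lemma matvec_ebasis (n : nat) (A : mat) (i j : nat) :
  (j < n)%nat -> matvec n A (ebasis j) i = A i j.
Proof.
  intros Hj. unfold matvec. rewrite <- (rsum_ebasis n j (A i) Hj).
  apply rsum_ext. intros; ring.
Qed.

Lemma Ainner_sym (n : nat) (A : mat) (x y : vec) :
  symmetric n A -> Ainner n A x y = Ainner n A y x.
Proof.
  intros H. unfold Ainner, matvec.
  rewrite (rsum_ext n _ (fun i => rsum n (fun r => y i * (A i r * x r))))
    by (intros; symmetry; apply rsum_scal).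
  rewrite rsum_swap. apply rsum_ext. intros i Hi.
  rewrite <- rsum_scal. apply rsum_ext. intros j Hj. rewrite (H j i Hj Hi). ring.
Qed.

Lemma Anorm2_add (n : nat) (A : mat) (x y : vec) (c : R) :
  symmetric n A ->
  Anorm2 n A (fun r => x r + c * y r) = Anorm2 n A x + 2 * c * Ainner n A x y + c ^ 2 * Anorm2 n A y.
Proof.
  intros H. unfold Anorm2.
  assert (E : Ainner n A x y = Ainner n A y x) by now apply Ainner_sym.
  replace (Ainner n A (fun r => x r + c * y r) (fun r => x r + c * y r))
    with (Ainner n A x x + c * Ainner n A x y + c * Ainner n A y x + c ^ 2 * Ainner n A y y).
  { rewrite <- E. ring. }
  unfold Ainner. rewrite <- !rsum_scal, <- !rsum_plus. apply rsum_ext. intros i Hi.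
  rewrite matvec_add. ring.
Qed.

(** For [c > 0] evaluate at the minimiser [t = - b / c]; for [c = 0] the expression is affine in
    [t], which forces [b = 0]. *)
Lemma discriminant_le (a b c : R) :
  0 <= c -> (forall t, 0 <= a + 2 * t * b + t ^ 2 * c) -> b ^ 2 <= a * c.
Proof.
  intros [Hc|<-] H.
  - specialize (H (- b / c)).
    replace (a + 2 * (- b / c) * b + (- b / c) ^ 2 * c) with ((a * c - b ^ 2) / c) in H by (field; lra).
    apply Rmult_le_compat_r with (r := c) in H; [|lra].
    unfold Rdiv in H. rewrite Rmult_assoc, Rinv_l in H; lra.
  - destruct (Req_dec b 0) as [->|Hb]; [lra|].
    (* This [t] makes [a + 2 t b] equal to [-1]. *)
    specialize (H (- (a + 1) / (2 * b))).
    replace (a + 2 * (- (a + 1) / (2 * b)) * b + (- (a + 1) / (2 * b)) ^ 2 * 0) with (-1) in H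
      by (field; lra).
    lra.
Qed.

Lemma dot_cauchy_schwarz (n : nat) (x y : vec) : dot n x y ^ 2 <= dot n x x * dot n y y.
Proof.
  apply discriminant_le; [apply dot_nonneg|]. intros t.
  apply Rle_trans with (1 := dot_nonneg n (fun i => x i + t * y i)), Req_le.
  unfold dot. rewrite <- !rsum_scal, <- !rsum_plus. apply rsum_ext. intros; ring.
Qed.

(** Stated for semidefinite forms, so that it also serves the singular shifts [t I - A]. *)
Lemma Ainner_cauchy_schwarz (n : nat) (A : mat) (x y : vec) :
  symmetric n A -> (forall z, 0 <= Anorm2 n A z) ->
  Ainner n A x y ^ 2 <= Anorm2 n A x * Anorm2 n A y.
Proof.
  intros Hs Hp. apply discriminant_le; [apply Hp|]. intros t.
  rewrite <- Anorm2_add by assumption. apply Hp.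
Qed.

(** * Kernel, left inverse and coercivity *)

Definition frob2 (n m : nat) (B : mat) : R := rsum m (fun i => rsum n (fun r => B i r * B i r)).

Lemma frob2_nonneg (n m : nat) (B : mat) : 0 <= frob2 n m B.
Proof. apply rsum_nonneg; intros; apply (dot_nonneg n (B i)). Qed.

Lemma matvec_bounded (n m : nat) (B : mat) (x : vec) :
  dot m (matvec n B x) (matvec n B x) <= frob2 n m B * dot n x x.
Proof.
  unfold frob2. rewrite Rmult_comm, <- rsum_scal. apply rsum_le. intros i Hi.
  generalize (dot_cauchy_schwarz n (B i) x). unfold dot, matvec. simpl. lra.
Qed.

(* If [B] inverts the first [n] columns on the left and [u] is the last column, then [u - M B u]
   is, up to sign, the image of the vector [(B u, -1)]; either it vanishes, or one of its nonzero
   entries recovers the last coordinate of the argument. *)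
Lemma left_inverse_or_kernel (n m : nat) (M : mat) :
  (exists v, nonzero_vec n v /\ forall i, (i < m)%nat -> matvec n M v i = 0) \/
  (exists B : mat, forall x i, (i < n)%nat -> x i = matvec m B (matvec n M x) i).
Proof.
  induction n as [|n IH].
  - right. exists (fun _ _ => 0). intros; lia.
  - destruct IH as [(v & (i & Hi & Hv) & Hk) | (B & HB)].
    + left. exists (fun r => if Nat.eqb r n then 0 else v r). split.
      * exists i. split; [lia|]. destruct (Nat.eqb_spec i n); [lia|assumption].
      * intros j Hj. unfold matvec. rewrite rsum_S, Nat.eqb_refl, Rmult_0_r, Rplus_0_r.
        rewrite <- (Hk j Hj). apply rsum_ext. intros r Hr.
        destruct (Nat.eqb_spec r n); [lia|reflexivity].
    + set (u := fun i => M i n).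
      set (w := fun i => u i - matvec n M (matvec m B u) i).
      destruct (classic (exists p, (p < m)%nat /\ w p <> 0)) as [(p & Hp & Hw)|Hw].
      * right.
        (* For [y = M x] one has [y - M B y = x_n w]; the row [L] reads entry [p] of this and
           divides by [w p]. *)
        set (L := fun r => (ebasis p r - rsum n (fun s => M p s * B s r)) / w p).
        assert (HL : forall x, rsum m (fun r => L r * matvec (S n) M x r) = x n).
        { intros x. set (y := matvec (S n) M x).
          assert (Hy : forall i, y i = matvec n M x i + x n * u i).
          { intros i. unfold y, matvec, u. rewrite rsum_S. ring. }
          assert (HBy : forall i, (i < n)%nat -> matvec m B y i = x i + x n * matvec m B u i).
          { intros i Hi. rewrite (HB x i Hi) at 1. rewrite <- matvec_add.
            apply rsum_ext. intros r Hr. rewrite Hy. reflexivity. }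
          assert (H1 : rsum m (fun r => L r * y r) = (y p - matvec n M (matvec m B y) p) / w p).
          { replace (y p) with (rsum m (fun r => ebasis p r * y r)) by now apply rsum_ebasis.
            replace (matvec n M (matvec m B y) p)
              with (rsum m (fun r => rsum n (fun s => M p s * B s r) * y r)).
            - unfold Rdiv. rewrite Rmult_comm.
              replace (rsum m (fun r => ebasis p r * y r) - rsum m (fun r => rsum n (fun s => M p s * B s r) * y r))
                with (rsum m (fun r => ebasis p r * y r) + (-1) * rsum m (fun r => rsum n (fun s => M p s * B s r) * y r)) by ring.
              rewrite <- rsum_scal, <- rsum_plus, <- rsum_scal. apply rsum_ext. intros r Hr.
              unfold L. field. assumption.
            - unfold matvec.
              rewrite (rsum_ext n (fun r => M p r * _) (fun s => rsum m (fun r => M p s * (B s r * y r))))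
                by (intros; symmetry; apply rsum_scal).
              rewrite rsum_swap. apply rsum_ext. intros r Hr.
              rewrite Rmult_comm, <- rsum_scal. apply rsum_ext. intros; ring. }
          fold y. rewrite H1.
          replace (matvec n M (matvec m B y) p)
            with (matvec n M (fun r => x r + x n * matvec m B u r) p)
            by (apply rsum_ext; intros; rewrite HBy by assumption; reflexivity).
          rewrite matvec_add, Hy. unfold w in *. field. assumption. }
        (* [B y] gives the first [n] coordinates of [x] plus [x_n B u]; the excess is removed with
           [L y = x_n]. *)
        exists (fun i r => if Nat.eqb i n then L r else B i r - matvec m B u i * L r).
        intros x i Hi. unfold matvec at 1. destruct (Nat.eqb_spec i n) as [->|Hne].
        -- symmetry. apply HL.
        -- set (y := matvec (S n) M x).
           transitivity (matvec m B y i + (- matvec m B u i) * rsum m (fun r => L r * y r)).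
           ++ unfold y at 2. rewrite HL, (HB x i) by lia.
              replace (matvec m B y i) with
                (matvec m B (fun r => matvec n M x r + x n * u r) i).
              ** rewrite matvec_add. ring.
              ** apply rsum_ext. intros r Hr. unfold y, matvec at 2. rewrite rsum_S. unfold u, matvec. ring.
           ++ rewrite <- rsum_scal. unfold matvec at 1. rewrite <- rsum_plus.
              apply rsum_ext. intros; ring.
      * left. exists (fun r => if Nat.eqb r n then -1 else matvec m B u r). split.
        -- exists n. split; [lia|]. rewrite Nat.eqb_refl. lra.
        -- intros i Hi. unfold matvec at 1. rewrite rsum_S, Nat.eqb_refl.
           rewrite (rsum_ext n _ (fun r => M i r * matvec m B u r)).
           ++ assert (w i = 0) by (apply NNPP; intros H; apply Hw; eauto).
              unfold w, u in H. unfold matvec in *. unfold u. lra.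
           ++ intros r Hr. destruct (Nat.eqb_spec r n); [lia|reflexivity].
Qed.

(** With [y = M x], Cauchy-Schwarz for the form of [M] gives [|y|^4 <= (x,x)_M (y,y)_M <= C |y|^2
    (x,x)_M]; divide by [|y|^2]. *)
Lemma norm_image_le_of_psd (n : nat) (M : mat) :
  symmetric n M -> (forall x, 0 <= Anorm2 n M x) ->
  forall C, (forall x, Anorm2 n M x <= C * dot n x x) ->
  forall x, dot n (matvec n M x) (matvec n M x) <= C * Anorm2 n M x.
Proof.
  intros Hs Hp C HC x. set (y := matvec n M x).
  assert (H1 := Ainner_cauchy_schwarz n M x y Hs Hp).
  assert (H2 : Ainner n M x y = dot n y y) by reflexivity.
  rewrite H2 in H1. assert (H3 := HC y). assert (H4 := Hp x).
  assert (H5 := HC x). assert (H6 := dot_nonneg n x).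
  destruct (dot_nonneg n y) as [H7|H7].
  - apply Rmult_le_reg_l with (dot n y y); [assumption|].
    apply Rle_trans with (Anorm2 n M x * Anorm2 n M y); nra.
  (* For [y = 0] only [0 <= C (x,x)_M] remains; if [(x,x)_M > 0], then [(x,x)_M <= C |x|^2] forces
     [C >= 0]. *)
  - rewrite <- H7. destruct H4 as [H4|H4]; [|nra].
    assert (0 <= C) by nra. nra.
Qed.

(** Takes the place of a compactness argument: a left inverse [B] bounds [|x|^2] by a multiple of
    [|M x|^2], which [norm_image_le_of_psd] bounds by a multiple of [(x,x)_M]. *)
Lemma coercive_or_kernel (n : nat) (M : mat) :
  symmetric n M -> (forall x, 0 <= Anorm2 n M x) ->
  (exists v, nonzero_vec n v /\ forall i, (i < n)%nat -> matvec n M v i = 0) \/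
  (exists delta, 0 < delta /\ forall x, delta * dot n x x <= Anorm2 n M x).
Proof.
  intros Hs Hp. destruct (left_inverse_or_kernel n n M) as [H|(B & HB)]; [now left|right].
  set (K := frob2 n n M). set (L := frob2 n n B).
  assert (HK : 0 <= K) by apply frob2_nonneg. assert (HL : 0 <= L) by apply frob2_nonneg.
  assert (Hup : forall x, Anorm2 n M x <= (1 + K) * dot n x x).
  { intros x. apply Rle_trans with (dot n x x + dot n (matvec n M x) (matvec n M x)).
    - unfold Anorm2, Ainner, dot. rewrite <- rsum_plus. apply rsum_le. intros.
      nra.
    - generalize (matvec_bounded n n M x). fold K. lra. }
  assert (Hpos : 0 < (1 + L) * (1 + K)) by (apply Rmult_lt_0_compat; lra).
  exists (/ ((1 + L) * (1 + K))). split; [now apply Rinv_0_lt_compat|]. intros x.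
  apply Rmult_le_reg_l with ((1 + L) * (1 + K)); [assumption|].
  rewrite <- Rmult_assoc, Rinv_r, Rmult_1_l by lra.
  assert (H1 := norm_image_le_of_psd n M Hs Hp _ Hup x).
  assert (H2 := matvec_bounded n n B (matvec n M x)). fold L in H2.
  assert (H3 := dot_nonneg n (matvec n M x)).
  apply Rle_trans with (L * dot n (matvec n M x) (matvec n M x)); [|nra].
  apply Rle_trans with (2 := H2), Req_le, rsum_ext. intros i Hi.
  now rewrite <- (HB x i Hi).
Qed.

(** * Rayleigh quotient bounds from the extreme eigenvalues *)

Definition shift_neg (t : R) (A : mat) : mat := fun i j => t * ebasis j i - A i j.

Lemma shift_neg_matvec (n : nat) (t : R) (A : mat) (x : vec) (i : nat) :
  (i < n)%nat -> matvec n (shift_neg t A) x i = t * x i - matvec n A x i.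
Proof.
  intros Hi. rewrite <- (rsum_ebasis n i x Hi).
  replace (t * rsum n (fun r => ebasis i r * x r) - matvec n A x i)
    with (t * rsum n (fun r => ebasis i r * x r) + (-1) * matvec n A x i) by ring.
  unfold matvec. rewrite <- !rsum_scal, <- rsum_plus. apply rsum_ext. intros r Hr.
  unfold shift_neg, ebasis. rewrite Nat.eqb_sym. ring.
Qed.

Lemma shift_neg_norm (n : nat) (t : R) (A : mat) (x : vec) :
  Anorm2 n (shift_neg t A) x = t * dot n x x - Anorm2 n A x.
Proof.
  replace (t * dot n x x - Anorm2 n A x) with (t * dot n x x + (-1) * Anorm2 n A x) by ring.
  unfold Anorm2, Ainner, dot. rewrite <- !rsum_scal, <- rsum_plus. apply rsum_ext. intros r Hr.
  rewrite shift_neg_matvec by assumption. ring.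
Qed.

Lemma shift_neg_sym (n : nat) (t : R) (A : mat) : symmetric n A -> symmetric n (shift_neg t A).
Proof.
  intros H i j Hi Hj. unfold shift_neg, ebasis. rewrite (H i j), Nat.eqb_sym by assumption. reflexivity.
Qed.

(* The infimum of the [t] such that [t I - A] is positive semidefinite is an eigenvalue:
   otherwise [t I - A] would be coercive there and [t] could be decreased. *)
Lemma norm_le_of_eigenvalues_le (n : nat) (A : mat) (lam : R) :
  (0 < n)%nat -> symmetric n A -> (forall mu, is_eigenvalue n A mu -> mu <= lam) ->
  forall x, Anorm2 n A x <= lam * dot n x x.
Proof.
  intros Hn Hs Hlam.
  (* [s] stands for [-t], so that the infimum sought becomes a supremum. *)
  set (P := fun s => forall x, Anorm2 n A x <= - s * dot n x x).
  assert (HPb : bound P).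
  { exists (- A O O). intros s Hsx. specialize (Hsx (ebasis 0)).
    unfold Anorm2, Ainner, dot in Hsx. rewrite !rsum_ebasis, matvec_ebasis in Hsx by assumption.
    unfold ebasis in Hsx; simpl in Hsx. lra. }
  assert (HPe : exists s, P s).
  { exists (- (1 + frob2 n n A)). intros x.
    apply Rle_trans with (dot n x x + dot n (matvec n A x) (matvec n A x)).
    - unfold Anorm2, Ainner, dot. rewrite <- rsum_plus. apply rsum_le. intros. nra.
    - generalize (matvec_bounded n n A x). lra. }
  destruct (completeness P HPb HPe) as [s [Hub Hlub]].
  (* The supremum is attained: a violation at [x] would allow lowering the upper bound [s] by the
     gap divided by [|x|^2]. *)
  assert (HsP : P s).
  { intros x. apply Rnot_lt_le. intros Hx. assert (Hd := dot_nonneg n x).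
    destruct Hd as [Hd|Hd].
    - assert (s <= s - (Anorm2 n A x - - s * dot n x x) / dot n x x).
      { apply Hlub. intros s' Hs'. specialize (Hs' x).
        apply Rmult_le_reg_r with (dot n x x); [assumption|].
        replace ((s - (Anorm2 n A x - - s * dot n x x) / dot n x x) * dot n x x)
          with (- Anorm2 n A x) by (field; lra). lra. }
      assert (0 < (Anorm2 n A x - - s * dot n x x) / dot n x x) by (apply Rdiv_lt_0_compat; lra).
      lra.
    - destruct HPe as [s' Hs']. specialize (Hs' x). rewrite <- Hd in *. lra. }
  destruct (coercive_or_kernel n (shift_neg (- s) A)) as [(v & Hv & Hk)|(delta & Hd & Hc)].
  - now apply shift_neg_sym.
  - intros x. rewrite shift_neg_norm. specialize (HsP x). lra.
  - assert (- s <= lam).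
    { apply Hlam. exists v. split; [assumption|]. intros i Hi. specialize (Hk i Hi).
      rewrite shift_neg_matvec in Hk by assumption. lra. }
    intros x. specialize (HsP x). assert (Hd := dot_nonneg n x). nra.
  - exfalso. assert (s + delta <= s); [|lra]. apply Hub. intros x. specialize (Hc x).
    rewrite shift_neg_norm in Hc. lra.
Qed.

(** The upper bound applied to [-A], written as [shift_neg 0 A]. *)
Lemma norm_ge_of_eigenvalues_ge (n : nat) (A : mat) (lam : R) :
  (0 < n)%nat -> symmetric n A -> (forall mu, is_eigenvalue n A mu -> lam <= mu) ->
  forall x, lam * dot n x x <= Anorm2 n A x.
Proof.
  intros Hn Hs Hlam x.
  assert (H := norm_le_of_eigenvalues_le n (shift_neg 0 A) (- lam) Hn (shift_neg_sym n 0 A Hs)).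
  enough (Anorm2 n (shift_neg 0 A) x <= - lam * dot n x x) by (rewrite shift_neg_norm in H0; lra).
  apply H. intros mu (v & Hv & Hmu). apply Ropp_le_cancel. rewrite Ropp_involutive.
  apply Hlam. exists v. split; [assumption|]. intros i Hi. specialize (Hmu i Hi).
  rewrite shift_neg_matvec in Hmu by assumption. lra.
Qed.

Lemma pos_def_norm_nonneg (n : nat) (A : mat) (x : vec) : pos_def n A -> 0 <= Anorm2 n A x.
Proof.
  intros H. destruct (classic (nonzero_vec n x)) as [Hx|Hx]; [now apply Rlt_le, H|].
  apply Req_le. unfold Anorm2, Ainner. rewrite (rsum_ext n _ (fun _ => 0)); [rewrite rsum_const; ring|].
  intros i Hi. replace (x i) with 0; [ring|]. symmetry. apply NNPP. intros Hn. apply Hx. now exists i.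
Qed.

Lemma norm_eigenvector (n : nat) (A : mat) (lam : R) (v : vec) :
  (forall i, (i < n)%nat -> matvec n A v i = lam * v i) -> Anorm2 n A v = lam * dot n v v.
Proof.
  intros H. unfold Anorm2, Ainner, dot. rewrite <- rsum_scal. apply rsum_ext. intros i Hi.
  rewrite H by assumption. ring.
Qed.

Lemma eigenvalue_pos (n : nat) (A : mat) (lam : R) :
  pos_def n A -> is_eigenvalue n A lam -> 0 < lam.
Proof.
  intros H (v & Hv & Hlam). specialize (H v Hv). rewrite (norm_eigenvector n A lam v Hlam) in H.
  apply dot_pos in Hv. nra.
Qed.

(* Projecting [e_i] off the eigenvector [v] leaves a vector of squared norm
   [1 - lam v_i^2 / |v|^2]; these norms add up to [n - lam], and they cannot all vanish. *)
Lemma eigenvalue_lt_dim (n : nat) (A : mat) (lam : R) :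
  (2 <= n)%nat -> symmetric n A -> pos_def n A -> unit_diag n A ->
  is_eigenvalue n A lam -> lam < INR n.
Proof.
  intros Hn Hs Hp Hd (v & Hv & Hlam). set (N := dot n v v).
  assert (HN : 0 < N) by now apply dot_pos.
  set (w := fun i r => ebasis i r + (- v i / N) * v r).
  assert (Hw : forall i, (i < n)%nat -> Anorm2 n A (w i) = 1 - lam / N * (v i * v i)).
  { intros i Hi. unfold w. rewrite Anorm2_add by assumption.
    rewrite (Ainner_sym n A (ebasis i) v) by assumption.
    unfold Ainner. rewrite rsum_ebasis, Hlam by assumption.
    rewrite (norm_eigenvector n A lam v Hlam). fold N.
    unfold Anorm2, Ainner. rewrite rsum_ebasis, matvec_ebasis, Hd by assumption.
    field. lra. }
  assert (Hsum : rsum n (fun i => Anorm2 n A (w i)) = INR n - lam).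
  { rewrite (rsum_ext n _ (fun i => 1 + (- (lam / N)) * (v i * v i)))
      by (intros; rewrite Hw by assumption; ring).
    rewrite rsum_plus, rsum_scal, rsum_const. fold (dot n v v). fold N. field. lra. }
  assert (Hnz : exists i, (i < n)%nat /\ nonzero_vec n (w i)).
  { apply NNPP. intros Hno.
    assert (Hz : forall i r, (i < n)%nat -> (r < n)%nat -> w i r = 0).
    { intros i r Hi Hr. apply NNPP. intros H. apply Hno. exists i. split; [assumption|]. now exists r. }
    (* Here [n >= 2] enters: these entries vanishing would give [v_0^2 = v_1^2 = N > 0] and
       [v_0 v_1 = 0]. *)
    assert (H00 := Hz 0%nat 0%nat ltac:(lia) ltac:(lia)).
    assert (H01 := Hz 0%nat 1%nat ltac:(lia) ltac:(lia)).
    assert (H11 := Hz 1%nat 1%nat ltac:(lia) ltac:(lia)).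
    unfold w, ebasis in H00, H01, H11; simpl in H00, H01, H11.
    assert (E00 : v 0%nat * v 0%nat = N).
    { replace (v 0%nat * v 0%nat) with (N - N * (1 + - v 0%nat / N * v 0%nat)) by (field; lra).
      rewrite H00. ring. }
    assert (E01 : v 0%nat * v 1%nat = 0).
    { replace (v 0%nat * v 1%nat) with (- N * (0 + - v 0%nat / N * v 1%nat)) by (field; lra).
      rewrite H01. ring. }
    assert (E11 : v 1%nat * v 1%nat = N).
    { replace (v 1%nat * v 1%nat) with (N - N * (1 + - v 1%nat / N * v 1%nat)) by (field; lra).
      rewrite H11. ring. }
    nra. }
  destruct Hnz as (i & Hi & Hi').
  assert (0 < INR n - lam); [|lra]. rewrite <- Hsum.
  apply Rlt_le_trans with (Anorm2 n A (w i)); [now apply Hp|].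
  apply (rsum_term_le n i (fun i => Anorm2 n A (w i))); [|assumption].
  intros; now apply pos_def_norm_nonneg.
Qed.
(** Cauchy-Schwarz for [x] and [A x] gives [(x,x)_A^2 <= |x|^2 |A x|^2], and [lam |x|^2 <= (x,x)_A]
    absorbs the factor [|x|^2]. *)
Lemma norm_image_ge (n : nat) (A : mat) (lam : R) (x : vec) :
  0 <= lam -> (forall y, 0 <= Anorm2 n A y) -> (forall y, lam * dot n y y <= Anorm2 n A y) ->
  lam * Anorm2 n A x <= dot n (matvec n A x) (matvec n A x).
Proof.
  intros Hl Hp HA. assert (H1 := dot_cauchy_schwarz n x (matvec n A x)).
  change (dot n x (matvec n A x)) with (Anorm2 n A x) in H1.
  assert (H2 := HA x). assert (H3 := dot_nonneg n (matvec n A x)).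
  destruct (Hp x) as [H4|H4]; [|rewrite <- H4; lra].
  apply Rmult_le_reg_l with (Anorm2 n A x); [assumption|].
  apply Rle_trans with (lam * (dot n x x * dot n (matvec n A x) (matvec n A x))).
  - replace (Anorm2 n A x * (lam * Anorm2 n A x)) with (lam * Anorm2 n A x ^ 2) by ring.
    now apply Rmult_le_compat_l.
  - rewrite <- Rmult_assoc. now apply Rmult_le_compat_r.
Qed.

Lemma rho_row (n : nat) (A : mat) (i : nat) :
  (i < n)%nat -> rsum n (fun r => Rabs (A i r)) / INR n <= rho n A.
Proof.
  intros Hi. unfold rho.
  assert (H : forall l x, In x l -> x <= fold_right Rmax 0 l).
  { induction l as [|y l IH]; intros x [].
    - subst. apply Rmax_l.
    - apply Rle_trans with (2 := Rmax_r _ _). now apply IH. }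
  apply H. apply in_map_iff. exists i. split; [unfold Rdiv; ring|]. apply in_seq. lia.
Qed.

Lemma rho_nonneg (n : nat) (A : mat) : 0 <= rho n A.
Proof.
  unfold rho. generalize (seq 0 n). intros l. induction l; simpl; [lra|].
  apply Rle_trans with (2 := Rmax_r _ _). assumption.
Qed.

(** * Expectation over independent uniform indices *)

Definition avg (n : nat) (f : nat -> R) : R := rsum n f / INR n.

Definition scons (i : nat) (d : nat -> nat) : nat -> nat :=
  fun j => match j with O => i | S j => d j end.

Definition upd (d : nat -> nat) (t i : nat) : nat -> nat :=
  fun j => if Nat.eqb j t then i else d j.

(* [F] is evaluated at sequences that vanish from index [m] on. *)
Fixpoint Ex (n m : nat) (F : (nat -> nat) -> R) : R :=
  match m with
  | O => F (fun _ => O)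
  | S m => avg n (fun i => Ex n m (fun d => F (scons i d)))
  end.

(** Measurability with respect to the first [m] draws; [T] is arbitrary so that vector-valued
    quantities are covered. *)
Definition depends_below (m : nat) {T : Type} (F : (nat -> nat) -> T) : Prop :=
  forall d d', (forall i, (i < m)%nat -> d i = d' i) -> F d = F d'.

Lemma avg_le (n : nat) (f g : nat -> R) :
  (0 < n)%nat -> (forall i, (i < n)%nat -> f i <= g i) -> avg n f <= avg n g.
Proof.
  intros Hn H. unfold avg, Rdiv. apply Rmult_le_compat_r; [|now apply rsum_le].
  apply Rlt_le, Rinv_0_lt_compat, lt_0_INR, Hn.
Qed.

Lemma avg_ext (n : nat) (f g : nat -> R) :
  (forall i, (i < n)%nat -> f i = g i) -> avg n f = avg n g.
Proof. intros H. unfold avg. now rewrite (rsum_ext n f g H). Qed.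

Lemma avg_const (n : nat) (c : R) : (0 < n)%nat -> avg n (fun _ => c) = c.
Proof. intros H. unfold avg. rewrite rsum_const. field. now apply not_0_INR, Nat.neq_0_lt_0. Qed.

Lemma avg_plus (n : nat) (f g : nat -> R) : avg n (fun i => f i + g i) = avg n f + avg n g.
Proof. unfold avg. rewrite rsum_plus. unfold Rdiv. ring. Qed.

Lemma avg_scal (n : nat) (c : R) (f : nat -> R) : avg n (fun i => c * f i) = c * avg n f.
Proof. unfold avg. rewrite rsum_scal. unfold Rdiv. ring. Qed.

Lemma Ex_le (n m : nat) (F G : (nat -> nat) -> R) :
  (0 < n)%nat -> (forall d, (forall j, (d j < n)%nat) -> F d <= G d) -> Ex n m F <= Ex n m G.
Proof.
  intros Hn. revert F G. induction m as [|m IH]; intros F G H; simpl.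
  - apply H. intros; exact Hn.
  - apply avg_le; [assumption|]. intros i Hi. apply IH. intros d Hd. apply H.
    intros [|j]; simpl; auto.
Qed.

Lemma Ex_ext (n m : nat) (F G : (nat -> nat) -> R) :
  (0 < n)%nat -> (forall d, (forall j, (d j < n)%nat) -> F d = G d) -> Ex n m F = Ex n m G.
Proof.
  intros Hn H. apply Rle_antisym; apply Ex_le; try assumption;
    intros d Hd; rewrite (H d Hd); apply Rle_refl.
Qed.

Lemma Ex_plus (n m : nat) (F G : (nat -> nat) -> R) :
  Ex n m (fun d => F d + G d) = Ex n m F + Ex n m G.
Proof.
  revert F G. induction m as [|m IH]; intros F G; simpl; [reflexivity|].
  rewrite <- avg_plus. apply avg_ext. intros. apply IH.
Qed.

Lemma Ex_scal (n m : nat) (c : R) (F : (nat -> nat) -> R) :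
  Ex n m (fun d => c * F d) = c * Ex n m F.
Proof.
  revert F. induction m as [|m IH]; intros F; simpl; [reflexivity|].
  rewrite <- avg_scal. apply avg_ext. intros. apply IH.
Qed.

Lemma Ex_const (n m : nat) (c : R) : (0 < n)%nat -> Ex n m (fun _ => c) = c.
Proof.
  intros Hn. induction m as [|m IH]; simpl; [reflexivity|].
  rewrite (avg_ext n _ (fun _ => c)); [now apply avg_const|]. intros; apply IH.
Qed.

Lemma Ex_rsum (n m L : nat) (F : nat -> (nat -> nat) -> R) :
  (0 < n)%nat -> Ex n m (fun d => rsum L (fun s => F s d)) = rsum L (fun s => Ex n m (F s)).
Proof.
  intros Hn. induction L as [|L IH].
  - apply (Ex_const n m 0 Hn).
  - rewrite rsum_S, <- IH, <- Ex_plus. apply Ex_ext; [assumption|]. intros; apply rsum_S.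
Qed.

(** Replacing [d_t] by an independent copy preserves the joint law; this allows averaging over a
    single index with the others fixed. *)
Lemma Ex_resample (n m t : nat) (F : (nat -> nat) -> R) :
  (0 < n)%nat -> (t < m)%nat ->
  Ex n m F = Ex n m (fun d => avg n (fun i => F (upd d t i))).
Proof.
  intros Hn. revert t F. induction m as [|m IH]; intros t F Ht; [lia|]. simpl.
  destruct t as [|t].
  - set (c := avg n (fun i => Ex n m (fun d => F (scons i d)))).
    symmetry. rewrite (avg_ext n _ (fun _ => c)); [now apply avg_const|].
    intros i _. unfold c, avg, Rdiv.
    rewrite Rmult_comm, <- Ex_rsum, <- Ex_scal by assumption.
    apply Ex_ext; [assumption|]. intros d _. rewrite Rmult_comm. f_equal.
    apply rsum_ext. intros i' _. f_equal. apply functional_extensionality. now intros [|j].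
  - apply avg_ext. intros i _. rewrite (IH t) by lia.
    apply Ex_ext; [assumption|]. intros d _. apply avg_ext. intros i' _. f_equal.
    apply functional_extensionality. now intros [|j].
Qed.

(** The recursion of [Ex] exposes the first index, whereas conditioning on the past requires
    averaging over the last one. *)
Lemma Ex_last (n m : nat) (F : (nat -> nat) -> R) :
  (0 < n)%nat -> Ex n (S m) F = Ex n m (fun d => avg n (fun i => F (upd d m i))).
Proof.
  intros Hn. revert F. induction m as [|m IH]; intros F.
  - simpl. apply avg_ext. intros i _. f_equal. apply functional_extensionality. now intros [|j].
  - change (avg n (fun i => Ex n (S m) (fun d => F (scons i d))) =
            avg n (fun i => Ex n m (fun d => avg n (fun i' => F (upd (scons i d) (S m) i'))))).
    apply avg_ext. intros i _. rewrite IH. apply Ex_ext; [assumption|]. intros d _.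
    apply avg_ext. intros i' _. f_equal. apply functional_extensionality. now intros [|j].
Qed.

Lemma upd_other (d : nat -> nat) (t i j : nat) : j <> t -> upd d t i j = d j.
Proof. unfold upd. now destruct (Nat.eqb_spec j t). Qed.

Lemma upd_same (d : nat -> nat) (t i : nat) : upd d t i t = i.
Proof. unfold upd. now rewrite Nat.eqb_refl. Qed.

(** Draws that [F] does not read average out, so quantities of different times can be compared over
    one horizon. *)
Lemma Ex_horizon (n m p : nat) (F : (nat -> nat) -> R) :
  (0 < n)%nat -> (m <= p)%nat -> depends_below m F -> Ex n p F = Ex n m F.
Proof.
  intros Hn Hp HF. induction Hp as [|p Hp IH]; [reflexivity|].
  rewrite <- IH, Ex_last by assumption. apply Ex_ext; [assumption|]. intros d _.
  rewrite (avg_ext n _ (fun _ => F d)); [now apply avg_const|].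
  intros i _. apply HF. intros j Hj. apply upd_other. lia.
Qed.

(** Links the list average in [Err] to [Ex]; the default [O] of [nth] matches the zero tail at which
    [Ex] evaluates [F]. *)
Lemma sum_all_seqs (n m : nat) (F : (nat -> nat) -> R) :
  (0 < n)%nat ->
  fold_right Rplus 0 (map (fun l => F (fun j => nth j l O)) (all_seqs n m)) = INR n ^ m * Ex n m F.
Proof.
  intros Hn. revert F. induction m as [|m IH]; intros F; simpl.
  - replace (fun j : nat => match j with O | _ => O end) with (fun _ : nat => O); [ring|].
    apply functional_extensionality. now intros [|j].
  - assert (Happ : forall l l', fold_right Rplus 0 (l ++ l') = fold_right Rplus 0 l + fold_right Rplus 0 l').
    { induction l as [|x l IHl]; intros l'; simpl; [ring|]. rewrite IHl. ring. }
    transitivity (rsum n (fun i => INR n ^ m * Ex n m (fun d => F (scons i d)))).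
    + unfold rsum. induction (seq 0 n) as [|i l IHl]; simpl; [reflexivity|].
      rewrite map_app, Happ, IHl. f_equal. rewrite <- IH, map_map. f_equal.
    + rewrite rsum_scal. unfold avg. field. now apply not_0_INR, Nat.neq_0_lt_0.
Qed.

(** Summation by parts: moving the window one step lowers the weight of each old term by 1, and the
    new term enters with weight [p]. *)
Lemma weighted_sum_shift (p j : nat) (G : nat -> R) :
  rsum p (fun u => (INR u + 1) * G (S j + u)%nat)
  = rsum p (fun u => (INR u + 1) * G (j + u)%nat) + INR p * G (j + p)%nat
    - rsum p (fun u => G (j + u)%nat).
Proof.
  induction p as [|p IH]; [unfold rsum; simpl; ring|].
  rewrite !rsum_S, IH, S_INR. replace (S j + p)%nat with (j + S p)%nat by lia. ring.
Qed.

Lemma pow_antitone (q : R) (i j : nat) : 0 <= q <= 1 -> (i <= j)%nat -> q ^ j <= q ^ i.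
Proof.
  intros Hq H. induction H as [|j H IH]; [lra|]. simpl.
  assert (0 <= q ^ j) by (apply pow_le; lra). nra.
Qed.

(** * The iteration *)

Section Iteration.

Context (n : nat) (A : mat) (xstar x0 : vec) (beta : R) (k : nat -> nat).
Hypothesis n_pos : (0 < n)%nat.
Hypothesis A_sym : symmetric n A.
Hypothesis A_diag : unit_diag n A.
Hypothesis k_le : forall j, (k j <= j)%nat.

Notation X := (iterate n A xstar x0 beta k).

Definition err (d : nat -> nat) (j : nat) : vec := vsub (X d j) xstar.

(* The opposite of the paper's gamma_j. *)
Definition res (d : nat -> nat) (j : nat) : R := matvec n A (err d (k j)) (d j).

(** The mean [g_j] of the squared [gamma_j]; [S j] draws, because [res d j] also reads [d j]. *)
Definition meansq (j : nat) : R := Ex n (S j) (fun d => res d j ^ 2).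

Notation E := (Err n A xstar x0 beta k).

Lemma hist_length d m : length (hist n A xstar x0 beta k d m) = S m.
Proof. induction m as [|m IH]; [reflexivity|]. simpl. rewrite length_app, IH. simpl. lia. Qed.

Lemma nth_hist d i m : (i <= m)%nat -> nth i (hist n A xstar x0 beta k d m) x0 = X d i.
Proof.
  induction m as [|m IH]; intros Hi.
  - now replace i with 0%nat by lia.
  - destruct (Nat.eq_dec i (S m)) as [->|Hne]; [reflexivity|].
    simpl. rewrite app_nth1 by (rewrite hist_length; lia). apply IH. lia.
Qed.

Lemma err_S d j :
  (d j < n)%nat ->
  err d (S j) = fun r => err d j r + (- beta * res d j) * ebasis (d j) r.
Proof.
  intros Hd. apply functional_extensionality. intros r. unfold err, vsub at 1.
  unfold iterate at 1. simpl. rewrite app_nth2; rewrite hist_length; [|lia].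
  rewrite Nat.sub_diag. simpl. rewrite !nth_hist by auto.
  unfold Ainner. rewrite rsum_ebasis by assumption.
  replace (matvec n A (vsub xstar (X d (k j))) (d j)) with (- res d j).
  - unfold vsub. ring.
  - unfold res, matvec. replace (- rsum n (fun r => A (d j) r * err d (k j) r))
      with ((-1) * rsum n (fun r => A (d j) r * err d (k j) r)) by ring.
    rewrite <- rsum_scal. apply rsum_ext. intros i Hi. unfold err, vsub. ring.
Qed.

Lemma err_depends j : depends_below j (fun d => err d j).
Proof.
  intros d d' H. unfold err. f_equal. unfold iterate. f_equal.
  induction j as [|j IH]; [reflexivity|]. simpl.
  rewrite IH, (H j) by auto with arith. reflexivity.
Qed.

(** The iterate with index [k j] involves only draws before [k j], so those made during the delay do
    not enter. *)
Lemma res_upd d j t i : (k j <= t)%nat -> (t < j)%nat -> res (upd d t i) j = res d j.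
Proof.
  intros H1 H2. unfold res. rewrite upd_other by lia. f_equal.
  apply err_depends. intros s Hs. apply upd_other. lia.
Qed.

Lemma res_upd_above d j t i : (j < t)%nat -> res (upd d t i) j = res d j.
Proof.
  intros H. unfold res. rewrite upd_other by lia. f_equal.
  apply err_depends. intros s Hs. apply upd_other. specialize (k_le j). lia.
Qed.

Lemma Err_eq_Ex m p : (m <= p)%nat -> E m = Ex n p (fun d => Anorm2 n A (err d m)).
Proof.
  intros Hp. rewrite (Ex_horizon n m p); [|assumption|assumption|].
  - assert (H := sum_all_seqs n m (fun d => Anorm2 n A (err d m)) n_pos).
    unfold Err. unfold err at 1 in H. rewrite H.
    field. now apply pow_nonzero, not_0_INR, Nat.neq_0_lt_0.
  - intros d d' H. f_equal. now apply err_depends.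
Qed.

Lemma meansq_eq_Ex j p : (j < p)%nat -> meansq j = Ex n p (fun d => res d j ^ 2).
Proof.
  intros Hp. symmetry. apply Ex_horizon; [assumption|assumption|].
  intros d d' H. unfold res. rewrite (H j) by lia.
  do 2 f_equal. apply err_depends. intros s Hs. apply H. specialize (k_le j). lia.
Qed.

Lemma meansq_nonneg j : 0 <= meansq j.
Proof.
  rewrite <- (Ex_const n (S j) 0 n_pos). apply Ex_le; [assumption|]. intros. apply pow2_ge_0.
Qed.

Lemma Err_nonneg m : (forall x, 0 <= Anorm2 n A x) -> 0 <= E m.
Proof.
  intros H. rewrite (Err_eq_Ex m m), <- (Ex_const n m 0 n_pos) by lia.
  apply Ex_le; auto.
Qed.

Lemma norm_err_step d j (c : R) :
  (d j < n)%nat ->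
  Anorm2 n A (fun r => err d j r + c * ebasis (d j) r)
  = Anorm2 n A (err d j) + 2 * c * matvec n A (err d j) (d j) + c ^ 2.
Proof.
  intros Hd. rewrite Anorm2_add by assumption.
  unfold Ainner at 1. rewrite rsum_ebasis by assumption.
  unfold Anorm2 at 2. unfold Ainner. rewrite rsum_ebasis, matvec_ebasis, A_diag by assumption.
  ring.
Qed.

(** Unrolls the updates between times [p] and [p + L]; with [p = k j] it compares the current
    residual with the stale one. *)
Lemma residual_delay d p L i :
  (forall j, (d j < n)%nat) ->
  matvec n A (err d (p + L)) i
  = matvec n A (err d p) i - beta * rsum L (fun s => res d (p + s) * A i (d (p + s)%nat)).
Proof.
  intros Hd. induction L as [|L IH].
  - rewrite Nat.add_0_r. unfold rsum at 1; simpl. ring.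
  - rewrite Nat.add_succ_r, err_S, matvec_add, IH, rsum_S, matvec_ebasis by auto. ring.
Qed.

Lemma avg_row_le i c : (i < n)%nat -> 0 <= c -> avg n (fun r => c * Rabs (A i r)) <= rho n A * c.
Proof.
  intros Hi Hc. rewrite avg_scal, Rmult_comm. apply Rmult_le_compat_r; [assumption|].
  now apply rho_row.
Qed.

(* Both expectations are bounded by averaging over the one of the two indices
   [d j], [d t] that the squared residual does not involve. *)
Lemma Ex_cross_le j t :
  (k j <= t)%nat -> (t < j)%nat ->
  Ex n (S j) (fun d => (res d j ^ 2 + res d t ^ 2) * Rabs (A (d j) (d t)))
  <= rho n A * (meansq j + meansq t).
Proof.
  intros H1 H2.
  rewrite (Ex_ext _ _ _ (fun d => res d j ^ 2 * Rabs (A (d j) (d t)) + res d t ^ 2 * Rabs (A (d j) (d t))))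
    by (try assumption; intros; ring).
  rewrite Ex_plus, Rmult_plus_distr_l. apply Rplus_le_compat.
  - rewrite (Ex_resample n (S j) t), (meansq_eq_Ex j (S j)), <- Ex_scal by (assumption || lia).
    apply Ex_le; [assumption|]. intros d Hd.
    rewrite (avg_ext n _ (fun i => res d j ^ 2 * Rabs (A (d j) i))).
    + apply avg_row_le; [apply Hd|apply pow2_ge_0].
    + intros i _. rewrite res_upd, upd_same, upd_other by lia. reflexivity.
  - rewrite (Ex_resample n (S j) j), (meansq_eq_Ex t (S j)), <- Ex_scal by (assumption || lia).
    apply Ex_le; [assumption|]. intros d Hd.
    rewrite (avg_ext n _ (fun i => res d t ^ 2 * Rabs (A (d t) i))).
    + apply avg_row_le; [apply Hd|apply pow2_ge_0].
    + intros i Hi. rewrite res_upd_above, upd_same, upd_other by lia.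
      (* Symmetry turns the column average into a row average, which [rho] controls. *)
      now rewrite (A_sym i (d t) Hi (Hd t)).
Qed.

Lemma Err_step j :
  0 <= beta ->
  E (S j) <= E j - beta * (2 - beta) * meansq j
             + beta ^ 2 * rho n A * rsum (j - k j) (fun s => meansq j + meansq (k j + s)).
Proof.
  intros Hb. set (L := (j - k j)%nat).
  assert (HL : (k j + L)%nat = j) by (specialize (k_le j); unfold L; lia).
  rewrite (Err_eq_Ex (S j) (S j)), (Err_eq_Ex j (S j)), (meansq_eq_Ex j (S j)) by lia.
  (* The bound before averaging: the current residual is [res d j] minus [beta] times a sum over the
     delay, and that sum produces the cross terms. *)
  apply Rle_trans with
    (Ex n (S j) (fun d => Anorm2 n A (err d j) + - (beta * (2 - beta)) * res d j ^ 2
       + beta ^ 2 * rsum L (fun s => (res d j ^ 2 + res d (k j + s)%nat ^ 2)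
                                     * Rabs (A (d j) (d (k j + s)%nat))))).
  - apply Ex_le; [assumption|]. intros d Hd.
    rewrite err_S, norm_err_step by auto.
    assert (Hr := residual_delay d (k j) L (d j) Hd). rewrite HL in Hr. rewrite Hr.
    change (matvec n A (err d (k j)) (d j)) with (res d j).
    (* AM-GM in the form [2 u v a <= (u^2 + v^2) |a|]. *)
    assert (HS : 2 * (res d j * rsum L (fun s => res d (k j + s)%nat * A (d j) (d (k j + s)%nat)))
      <= rsum L (fun s => (res d j ^ 2 + res d (k j + s)%nat ^ 2) * Rabs (A (d j) (d (k j + s)%nat)))).
    { rewrite <- !rsum_scal. apply rsum_le. intros s _.
      set (u := res d j). set (v := res d (k j + s)%nat). set (a := A (d j) (d (k j + s)%nat)).
      destruct (Rcase_abs a) as [Ha|Ha];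
        [rewrite Rabs_left by assumption|rewrite Rabs_right by assumption];
        assert (0 <= (u - v) ^ 2) by apply pow2_ge_0;
        assert (0 <= (u + v) ^ 2) by apply pow2_ge_0; nra. }
    apply Rmult_le_compat_l with (r := beta ^ 2) in HS; [|apply pow2_ge_0]. lra.
  - rewrite !Ex_plus, !Ex_scal, Ex_rsum by assumption.
    assert (Hc : rsum L (fun s => Ex n (S j) (fun d => (res d j ^ 2 + res d (k j + s)%nat ^ 2)
                    * Rabs (A (d j) (d (k j + s)%nat))))
      <= rho n A * rsum L (fun s => meansq j + meansq (k j + s))).
    { rewrite <- rsum_scal. apply rsum_le. intros s Hs. apply Ex_cross_le; lia. }
    apply Rmult_le_compat_l with (r := beta ^ 2) in Hc; [|apply pow2_ge_0].
    fold (meansq j). lra.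
Qed.

Lemma avg_residual (x : vec) :
  avg n (fun i => matvec n A x i ^ 2) = dot n (matvec n A x) (matvec n A x) / INR n.
Proof. unfold avg, dot. f_equal. apply rsum_ext. intros; ring. Qed.

(** The draw [d_j] is uniform and independent of the error at any time [p <= j], so its conditional
    average can be taken first. *)
Lemma Ex_residual j p :
  (p <= j)%nat ->
  Ex n (S j) (fun d => matvec n A (err d p) (d j) ^ 2)
  = Ex n j (fun d => dot n (matvec n A (err d p)) (matvec n A (err d p)) / INR n).
Proof.
  intros Hp. rewrite Ex_last by assumption. apply Ex_ext; [assumption|]. intros d _.
  rewrite <- avg_residual. apply avg_ext. intros i _. rewrite upd_same.
  do 2 f_equal. apply err_depends. intros s Hs. apply upd_other. lia.
Qed.

Lemma Ex_residual_le lam j p :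
  (forall x, dot n (matvec n A x) (matvec n A x) <= lam * Anorm2 n A x) -> (p <= j)%nat ->
  Ex n (S j) (fun d => matvec n A (err d p) (d j) ^ 2) <= lam / INR n * E p.
Proof.
  intros H Hp. rewrite Ex_residual, (Err_eq_Ex p j), <- Ex_scal by assumption.
  apply Ex_le; [assumption|]. intros d _. specialize (H (err d p)).
  assert (0 < / INR n) by now apply Rinv_0_lt_compat, lt_0_INR.
  unfold Rdiv. nra.
Qed.

Lemma meansq_le lam j :
  (forall x, dot n (matvec n A x) (matvec n A x) <= lam * Anorm2 n A x) ->
  meansq j <= lam / INR n * E (k j).
Proof. intros H. now apply Ex_residual_le. Qed.

Lemma meansq_ge lam j :
  (forall x, lam * Anorm2 n A x <= dot n (matvec n A x) (matvec n A x)) ->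
  lam / INR n * E (k j) <= meansq j.
Proof.
  intros H. unfold meansq, res. rewrite Ex_residual, (Err_eq_Ex (k j) j), <- Ex_scal by auto.
  apply Ex_le; [assumption|]. intros d _. specialize (H (err d (k j))).
  assert (0 < / INR n) by now apply Rinv_0_lt_compat, lt_0_INR.
  unfold Rdiv. nra.
Qed.

(* Whatever the step length, a move along [d j] cannot do better than the exact line search. *)
Lemma Err_step_ge lam j :
  (forall x, dot n (matvec n A x) (matvec n A x) <= lam * Anorm2 n A x) ->
  (1 - lam / INR n) * E j <= E (S j).
Proof.
  intros H.
  apply Rle_trans with (E j + (-1) * Ex n (S j) (fun d => matvec n A (err d j) (d j) ^ 2)).
  - assert (H1 := Ex_residual_le lam j j H (le_n j)). lra.
  - rewrite (Err_eq_Ex j (S j)), (Err_eq_Ex (S j) (S j)), <- Ex_scal, <- Ex_plus by lia.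
    apply Ex_le; [assumption|]. intros d Hd. rewrite err_S, norm_err_step by auto.
    (* With [r] the current residual entry and [c] the step,
       [2 c r + c^2 = (r + c)^2 - r^2 >= - r^2]. *)
    assert (0 <= (matvec n A (err d j) (d j) + - beta * res d j) ^ 2) by apply pow2_ge_0.
    lra.
Qed.

Lemma Err_decay_ge lam s i :
  lam <= INR n ->
  (forall x, dot n (matvec n A x) (matvec n A x) <= lam * Anorm2 n A x) ->
  (1 - lam / INR n) ^ i * E s <= E (s + i).
Proof.
  intros Hlam H. induction i as [|i IH]; [rewrite Nat.add_0_r; simpl; lra|].
  rewrite Nat.add_succ_r. apply Rle_trans with (2 := Err_step_ge lam (s + i) H).
  simpl. rewrite Rmult_assoc. apply Rmult_le_compat_l; [|assumption].
  assert (0 < INR n) by now apply lt_0_INR.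
  assert (lam / INR n <= 1); [|lra].
  apply Rmult_le_reg_r with (INR n); [assumption|].
  unfold Rdiv. rewrite Rmult_assoc, Rinv_l; lra.
Qed.

(** * The Lyapunov function *)

Context (tau : nat).
Hypothesis k_ge : forall j, (j <= k j + tau)%nat.

Notation nuv := (nu (rho n A) tau beta).

(** [g_(u - tau)] with value 0 at negative times; shifting the index by [tau] keeps the window
    within the natural numbers. *)
Definition past_meansq (u : nat) : R := if (u <? tau)%nat then 0 else meansq (u - tau).

(* The weights are those for which the cross terms of [Err_step] telescope. *)
Definition lyapunov (j : nat) : R :=
  E j + beta ^ 2 * rho n A * rsum tau (fun u => (INR u + 1) * past_meansq (j + u)).

Lemma past_meansq_nonneg u : 0 <= past_meansq u.
Proof. unfold past_meansq. destruct (u <? tau)%nat; [lra|apply meansq_nonneg]. Qed.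

Lemma past_meansq_add j : past_meansq (j + tau) = meansq j.
Proof.
  unfold past_meansq. destruct (Nat.ltb_spec (j + tau) tau); [lia|]. f_equal; lia.
Qed.

(** The steps since [k j] form the end of the window of the last [tau] steps, and the rest of the
    window is nonnegative. *)
Lemma delay_sum_le j :
  rsum (j - k j) (fun s => meansq j + meansq (k j + s))
  <= INR tau * meansq j + rsum tau (fun u => past_meansq (j + u)).
Proof.
  specialize (k_le j). specialize (k_ge j). set (L := (j - k j)%nat) in *.
  rewrite rsum_plus, rsum_const. apply Rplus_le_compat.
  - apply Rmult_le_compat_r; [apply meansq_nonneg|]. apply le_INR. unfold L; lia.
  - replace tau with ((tau - L) + L)%nat at 1 by (unfold L; lia). rewrite rsum_split.
    assert (0 <= rsum (tau - L) (fun u => past_meansq (j + u)))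
      by (apply rsum_nonneg; intros; apply past_meansq_nonneg).
    enough (rsum L (fun s => meansq (k j + s))
            = rsum L (fun i => past_meansq (j + (tau - L + i)))) by lra.
    apply rsum_ext. intros s Hs. rewrite <- past_meansq_add. f_equal. unfold L in *; lia.
Qed.

(** Up to the factor [beta^2 rho], [Err_step] adds [tau g_j] plus the window sum and the shift of
    the weights adds [tau g_j] minus it; the total coefficient of [g_j] is [- nu]. *)
Lemma lyapunov_step j : 0 <= beta -> lyapunov (S j) <= lyapunov j - nuv * meansq j.
Proof.
  intros Hb. unfold lyapunov, nu. rewrite weighted_sum_shift, past_meansq_add.
  assert (H1 := Err_step j Hb). assert (H2 := delay_sum_le j).
  apply Rmult_le_compat_l with (r := beta ^ 2 * rho n A) in H2;
    [|apply Rmult_le_pos; [apply pow2_ge_0|apply rho_nonneg]].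
  lra.
Qed.

Lemma Err_le_lyapunov j : E j <= lyapunov j.
Proof.
  unfold lyapunov. enough (0 <= beta ^ 2 * rho n A * rsum tau (fun u => (INR u + 1) * past_meansq (j + u))) by lra.
  apply Rmult_le_pos; [apply Rmult_le_pos; [apply pow2_ge_0|apply rho_nonneg]|].
  apply rsum_nonneg. intros u _. apply Rmult_le_pos; [|apply past_meansq_nonneg].
  generalize (pos_INR u); lra.
Qed.

(** No step precedes time 0; this is why (a) carries no [chi]. *)
Lemma lyapunov_0 : lyapunov 0 = E O.
Proof.
  unfold lyapunov. rewrite (rsum_ext tau _ (fun _ => 0)); [rewrite rsum_const; ring|].
  intros u Hu. unfold past_meansq. simpl. destruct (Nat.ltb_spec u tau); [ring|lia].
Qed.

Lemma Err_le_lyapunov_start s p :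
  0 <= beta -> E (s + p) <= lyapunov s - nuv * rsum p (fun i => meansq (s + i)).
Proof.
  intros Hb. apply Rle_trans with (1 := Err_le_lyapunov (s + p)).
  induction p as [|p IH].
  - rewrite Nat.add_0_r. unfold rsum; simpl. lra.
  - rewrite Nat.add_succ_r, rsum_S. assert (H := lyapunov_step (s + p) Hb). lra.
Qed.

(** * Contraction from the spectral bounds *)

Context (lmin lmax : R).
Hypothesis norm_nonneg : forall x, 0 <= Anorm2 n A x.
Hypothesis image_le : forall x, dot n (matvec n A x) (matvec n A x) <= lmax * Anorm2 n A x.
Hypothesis image_ge : forall x, lmin * Anorm2 n A x <= dot n (matvec n A x) (matvec n A x).
Hypothesis lmin_pos : 0 < lmin.
Hypothesis lmax_pos : 0 < lmax.
Hypothesis lmax_lt : lmax < INR n.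

Notation q := (1 - lmax / INR n).

Lemma q_bounds : 0 < q < 1.
Proof.
  assert (Hn : 0 < INR n) by lra.
  assert (0 < lmax / INR n) by now apply Rdiv_lt_0_compat.
  assert (lmax / INR n < 1); [|lra].
  apply Rmult_lt_reg_r with (INR n); [assumption|].
  unfold Rdiv. rewrite Rmult_assoc, Rinv_l; lra.
Qed.

Lemma Err_ge s j p : (s <= j)%nat -> (j <= s + p)%nat -> q ^ p * E s <= E j.
Proof.
  intros H1 H2. replace j with (s + (j - s))%nat by lia.
  apply Rle_trans with (q ^ (j - s) * E s).
  - apply Rmult_le_compat_r; [now apply Err_nonneg|].
    apply pow_antitone; [generalize q_bounds; lra|lia].
  - apply Err_decay_ge; [lra|assumption].
Qed.

(** Steps in the window read iterates at most [2 tau] old, whose error is at most [q^(-2 tau) E_s]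
    because one step keeps at least the fraction [q]. There are [tau] terms with weights at most
    [tau], whence [tau^2]. *)
Lemma lyapunov_le s :
  lyapunov s <= (1 + rho n A * INR tau ^ 2 * beta ^ 2 * lmax * (/ q) ^ (2 * tau) / INR n) * E s.
Proof.
  assert (Hq := q_bounds). assert (HE := Err_nonneg s norm_nonneg).
  assert (Hqt : 0 < q ^ (2 * tau)) by (apply pow_lt; lra).
  set (G := lmax / INR n * ((/ q) ^ (2 * tau) * E s)).
  assert (Hl : 0 <= lmax / INR n) by lra.
  assert (HG : 0 <= G).
  { apply Rmult_le_pos; [assumption|]. apply Rmult_le_pos; [|assumption].
    rewrite pow_inv. now apply Rlt_le, Rinv_0_lt_compat. }
  assert (HW : rsum tau (fun u => (INR u + 1) * past_meansq (s + u)) <= INR tau * (INR tau * G)).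
  { rewrite <- rsum_const. apply rsum_le. intros u Hu.
    rewrite <- S_INR. apply Rmult_le_compat;
      [apply pos_INR|apply past_meansq_nonneg|apply le_INR; lia|].
    unfold past_meansq. destruct (Nat.ltb_spec (s + u) tau) as [_|Ht]; [assumption|].
    set (t := (s + u - tau)%nat). apply Rle_trans with (1 := meansq_le lmax t image_le).
    apply Rmult_le_compat_l; [assumption|].
    apply Rmult_le_reg_l with (q ^ (2 * tau)); [assumption|].
    rewrite pow_inv, <- Rmult_assoc, Rinv_r, Rmult_1_l by lra.
    apply Err_ge; specialize (k_le t); specialize (k_ge t); unfold t in *; lia. }
  unfold lyapunov.
  apply Rmult_le_compat_l with (r := beta ^ 2 * rho n A) in HW;
    [|apply Rmult_le_pos; [apply pow2_ge_0|apply rho_nonneg]].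
  unfold G in HW. unfold Rdiv in *. lra.
Qed.

(** Reads no older than [s] give [g_(s+a+i) >= (lmin / n) q^(a+i) E_s]; in the geometric sum
    [1 - q = lmax / n] replaces [n] by [lmax]. *)
Lemma meansq_sum_ge s a p :
  (forall i, (i < p)%nat -> (s <= k (s + (a + i)))%nat) ->
  lmin / lmax * (q ^ a * (1 - q ^ p)) * E s <= rsum p (fun i => meansq (s + (a + i))).
Proof.
  intros Hk. assert (Hq := q_bounds).
  apply Rle_trans with (rsum p (fun i => (lmin / INR n * q ^ a * E s) * q ^ i)).
  - rewrite (rsum_scal p _ (pow q)), <- rsum_geom. change (fun i => q ^ i) with (pow q).
    apply Req_le. field. lra.
  - apply rsum_le. intros i Hi. apply Rle_trans with (2 := meansq_ge lmin _ image_ge).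
    replace (lmin / INR n * q ^ a * E s * q ^ i) with (lmin / INR n * (q ^ (a + i) * E s))
      by (rewrite pow_add; ring).
    apply Rmult_le_compat_l; [apply Rlt_le, Rdiv_lt_0_compat; lra|].
    apply Err_ge; [now apply Hk|apply k_le].
Qed.

(** Common core of (a) and (b): the gain of the first [a] steps is discarded, so that no later read
    precedes [s], and [p] further steps bring the geometric sum to at least half of its limit. *)
Lemma Err_contract s a p m :
  0 <= beta -> 0 <= nuv -> q ^ p <= 1 / 2 -> (s + (a + p) <= m)%nat ->
  (forall i, (i < m)%nat -> (s <= k (s + (a + i)))%nat) ->
  E m <= lyapunov s - nuv * q ^ a / (2 * (lmax / lmin)) * E s.
Proof.
  intros Hb Hnu Hp Hm Hk. assert (Hq := q_bounds).
  (* All steps left after the first [a], possibly more than [p]. *)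
  set (p' := (m - s - a)%nat).
  replace m with (s + (a + p'))%nat by (unfold p'; lia).
  apply Rle_trans with (1 := Err_le_lyapunov_start s (a + p') Hb).
  enough (q ^ a / (2 * (lmax / lmin)) * E s <= rsum (a + p') (fun i => meansq (s + i))) as H.
  { apply Rmult_le_compat_l with (r := nuv) in H; [|assumption]. unfold Rdiv in *. lra. }
  rewrite rsum_split.
  assert (H1 : 0 <= rsum a (fun i => meansq (s + i)))
    by (apply rsum_nonneg; intros; apply meansq_nonneg).
  assert (H2 := meansq_sum_ge s a p').
  assert (H3 : q ^ p' <= q ^ p) by (apply pow_antitone; [lra|unfold p'; lia]).
  apply Rle_trans with (lmin / lmax * (q ^ a * (1 - q ^ p')) * E s).
  - apply Rmult_le_compat_r; [now apply Err_nonneg|].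
    replace (q ^ a / (2 * (lmax / lmin))) with (lmin / lmax * (q ^ a * (1 / 2))) by (field; lra).
    apply Rmult_le_compat_l; [apply Rlt_le, Rdiv_lt_0_compat; lra|].
    apply Rmult_le_compat_l; [apply pow_le; lra|lra].
  - apply Rle_trans with (rsum p' (fun i => meansq (s + (a + i)))); [|lra].
    apply H2. intros i Hi. apply Hk. unfold p' in Hi; lia.
Qed.

End Iteration.

(** * Waiting time and conclusion *)

Lemma pow_le_half (q : R) (m : nat) :
  0 < q < 1 -> ln (1 / 2) / ln q <= INR m -> q ^ m <= 1 / 2.
Proof.
  intros Hq Hm. assert (Hl : ln q < 0) by (rewrite <- ln_1; apply ln_increasing; lra).
  apply Rmult_le_compat_r with (r := - ln q) in Hm; [|lra].
  replace (ln (1 / 2) / ln q * - ln q) with (- ln (1 / 2)) in Hm by (field; lra).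
  rewrite <- (exp_ln (q ^ m)) by (apply pow_lt; lra).
  rewrite <- (exp_ln (1 / 2)) by lra. rewrite ln_pow by lra.
  destruct (Rle_lt_or_eq (INR m * ln q) (ln (1 / 2))) as [H|H]; [lra| |rewrite H; lra].
  now apply Rlt_le, exp_increasing.
Qed.

(** [Z.to_nat] sends negative integers to 0, which only enlarges the right side. *)
Lemma le_INR_ceilZ (x : R) : x <= INR (Z.to_nat (ceilZ x)).
Proof.
  apply Rle_trans with (IZR (ceilZ x)).
  - unfold ceilZ. rewrite opp_IZR. generalize (base_Int_part (- x)). lra.
  - rewrite INR_IZR_INZ. apply IZR_le. lia.
Qed.

Theorem theorem2 (n : nat) (A : mat) (b xstar x0 : vec) (lmin lmax beta : R)
  (tau : nat) (k : nat -> nat) :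
  (2 <= n)%nat ->
  symmetric n A -> pos_def n A -> unit_diag n A ->
  is_min_eigenvalue n A lmin -> is_max_eigenvalue n A lmax ->
  (forall i, (i < n)%nat -> matvec n A xstar i = b i) ->
  (forall j, (j <= k j + tau)%nat /\ (k j <= j)%nat) ->
  0 < beta -> beta <= 1 ->
  0 < nu (rho n A) tau beta ->
  let kappa := lmax / lmin in
  let q := 1 - lmax / INR n in
  let E := Err n A xstar x0 beta k in
  let nuv := nu (rho n A) tau beta in
  (forall m : nat, INR m >= ln (1 / 2) / ln q ->
     E m <= (1 - nuv / (2 * kappa)) * E O) /\
  (let T0 := Z.to_nat (ceilZ (ln (1 / 2) / ln q)) in
   let T := (T0 + tau)%nat in
   let chi := rho n A * INR tau ^ 2 * beta ^ 2 * lmax * (/ q) ^ (2 * tau) / INR n in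
   forall (r m : nat), (1 <= r)%nat -> (r * T <= m)%nat ->
     E m <= (1 - nuv / (2 * kappa))
            * (1 - nuv * q ^ tau / (2 * kappa) + chi) ^ (r - 1) * E O).
Proof.
  intros Hn Hs Hp Hd [Hmin Hmin'] [Hmax Hmax'] _ Hk Hb Hb1 Hnu kappa q E nuv.
  assert (Hn0 : (0 < n)%nat) by lia.
  assert (Hkle : forall j, (k j <= j)%nat) by apply Hk.
  assert (Hkge : forall j, (j <= k j + tau)%nat) by apply Hk.
  assert (Hmin0 := eigenvalue_pos n A lmin Hp Hmin).
  assert (Hmax0 := eigenvalue_pos n A lmax Hp Hmax).
  assert (Hmaxn := eigenvalue_lt_dim n A lmax Hn Hs Hp Hd Hmax).
  assert (HA : forall x, 0 <= Anorm2 n A x) by (intros; now apply pos_def_norm_nonneg).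
  assert (Hup := norm_image_le_of_psd n A Hs HA lmax (norm_le_of_eigenvalues_le n A lmax Hn0 Hs Hmax')).
  assert (Hlo : forall x, lmin * Anorm2 n A x <= dot n (matvec n A x) (matvec n A x)).
  { intros x. apply norm_image_ge; [lra|assumption|].
    now apply norm_ge_of_eigenvalues_ge. }
  assert (Hq : 0 < q < 1) by now apply q_bounds.
  assert (Ha : forall m : nat, INR m >= ln (1 / 2) / ln q -> E m <= (1 - nuv / (2 * kappa)) * E O).
  { intros m Hm.
    (* From [s = 0] no read is too old, so [a = 0]. *)
    assert (H : E m <= lyapunov n A xstar x0 beta k tau 0 - nuv * q ^ 0 / (2 * kappa) * E O).
    { apply Err_contract with (p := m); try assumption; try lra; try lia.
      apply pow_le_half; [assumption|now apply Rge_le]. }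
    rewrite lyapunov_0 in H by assumption. fold E in H. simpl in H. unfold Rdiv in *. lra. }
  split; [exact Ha|]. intros T0 T chi.
  set (c := 1 - nuv * q ^ tau / (2 * kappa) + chi).
  assert (HT0 : ln (1 / 2) / ln q <= INR T0) by apply le_INR_ceilZ.
  (* The induction on [r] multiplies an inequality by [c]. *)
  assert (Hc : 0 <= c).
  { assert (Hkap : 1 <= kappa).
    { unfold kappa. apply Rmult_le_reg_r with lmin; [assumption|].
      unfold Rdiv. rewrite Rmult_assoc, Rinv_l, Rmult_1_r, Rmult_1_l by lra.
      now apply Hmin'. }
    (* [2 beta - beta^2 = 1 - (1 - beta)^2]. *)
    assert (Hnu1 : nuv <= 1).
    { unfold nuv, nu. assert (0 <= rho n A * INR tau * beta ^ 2).
      { apply Rmult_le_pos; [apply Rmult_le_pos; [apply rho_nonneg|apply pos_INR]|apply pow2_ge_0]. }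
      assert (0 <= (1 - beta) ^ 2) by apply pow2_ge_0. lra. }
    assert (Hqt : 0 < q ^ tau <= 1).
    { split; [apply pow_lt; lra|]. apply (pow_antitone q 0 tau); [lra|lia]. }
    assert (Hchi : 0 <= chi).
    { unfold chi. apply Rmult_le_pos; [|apply Rlt_le, Rinv_0_lt_compat; lra].
      repeat apply Rmult_le_pos; try apply rho_nonneg; try apply pos_INR; try lra.
      apply pow_le, Rlt_le, Rinv_0_lt_compat; lra. }
    assert (Hfrac : nuv * q ^ tau / (2 * kappa) <= 1); [|unfold c; lra].
    apply Rmult_le_reg_r with (2 * kappa); [lra|].
    unfold Rdiv. rewrite Rmult_assoc, Rinv_l by lra. fold nuv in Hnu. nra. }
  (* One block: [tau] steps until every read is at or after [s], then [T0] steps for the half; [chi]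
     pays for the history at [s]. *)
  assert (Hstep : forall s m, (s + T <= m)%nat -> E m <= c * E s).
  { intros s m Hm.
    assert (H : E m <= lyapunov n A xstar x0 beta k tau s - nuv * q ^ tau / (2 * kappa) * E s).
    { apply Err_contract with (p := T0); try assumption; try lra.
      - now apply pow_le_half.
      - unfold T in Hm. lia.
      - intros i _. specialize (Hkge (s + (tau + i))%nat). lia. }
    assert (H' : lyapunov n A xstar x0 beta k tau s <= (1 + chi) * E s)
      by now apply lyapunov_le.
    unfold c. lra. }
  (* The first block uses (a); every later one contributes a factor [c]. *)
  intros r m Hr. revert m. induction Hr as [|r Hr IH]; intros m Hm.
  - simpl. rewrite Rmult_1_r. apply Ha. apply Rle_ge, Rle_trans with (1 := HT0), le_INR.
    unfold T in Hm. lia.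
  - apply Rle_trans with (c * E (r * T)%nat); [apply Hstep; simpl in Hm; lia|].
    specialize (IH (r * T)%nat (le_n _)).
    apply Rmult_le_compat_l with (r := c) in IH; [|assumption].
    replace (S r - 1)%nat with (S (r - 1)) by lia. simpl. lra.
Qed.
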